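(* Consider the block-randomized sampling process described in the context, with either the leverage-based or the Euclidean-based sampling probabilities. Let $\mathcal{B}_{(t)}$ be the filtration generated by the random variables $\{\xi_{(0)},\zeta_{(0)},\xi_{(1)},\zeta_{(1)},\dots,\xi_{(t-1)},\zeta_{(t-1)}\}$, so that the iterate $\boldsymbol{\theta}_{(t)}$ is determined conditioned on $\mathcal{B}_{(t)}$. Then the stochastic gradient $\mathbf{G}^{(\xi_{(t)})}_{(t)}$ is an unbiased estimate of the full gradient of $f$ with respect to $\mathbf{A}^{(\xi_{(t)})}$, i.e. $$\mathbb{E}_{\zeta_{(t)}}\left[\mathbf{G}^{(\xi_{(t)})}_{(t)}\;\middle|\;\mathcal{B}_{(t)},\xi_{(t)}\right]=\nabla_{\mathbf{A}^{(\xi_{(t)})}}f(\boldsymbol{\theta}_{(t)}).$$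
   Context: Let $\mathcal{X}\in\mathbb{R}^{I_1\times\cdots\times I_N}$ be a tensor, let $R$ be a positive integer with $I_k>R$ for all $k$, and let $\boldsymbol{\theta}=[\mathbf{A}^{(1)},\dots,\mathbf{A}^{(N)}]$ with factor matrices $\mathbf{A}^{(k)}\in\mathbb{R}^{I_k\times R}$. For a mode $n$ put $J_n=\prod_{m\ne n}I_m$. Indices $j\in\{1,\dots,J_n\}$ are in bijection with multi-indices $(i_k)_{k\neq n}$, $1\le i_k\le I_k$, via $j=1+\sum_{k\ne n}(i_k-1)\prod_{m<k,\,m\neq n}I_m$. The mode-$n$ unfolding $\mathbf{X}_{(n)}\in\mathbb{R}^{I_n\times J_n}$ has entry $\mathcal{X}_{i_1,\dots,i_N}$ at position $(i_n,j)$. The Khatri-Rao matrix $\mathbf{Z}^{(n)}=\mathbf{A}^{(N)}\odot\cdots\odot\mathbf{A}^{(n+1)}\odot\mathbf{A}^{(n-1)}\odot\cdots\odot\mathbf{A}^{(1)}\in\mathbb{R}^{J_n\times R}$ has as its $j$-th row the entrywise (Hadamard) product of the rows $\mathbf{A}^{(k)}(i_k,:)$, $k\neq n$. Objective: $f(\boldsymbol{\theta})=\frac12\|\mathcal{X}-\sum_{r=1}^R\mathbf{a}^{(1)}_r\circ\cdots\circ\mathbf{a}^{(N)}_r\|_F^2=\frac12\|\mathbf{Z}^{(n)}(\mathbf{A}^{(n)})^\top-\mathbf{X}_{(n)}^\top\|_F^2$ for each $n$, where $\mathbf{a}^{(k)}_r$ is the $r$-th column of $\mathbf{A}^{(k)}$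 and $\circ$ is the outer product. For a given mode $n$, $f=\frac1{J_n}\sum_{j=1}^{J_n}f_j$ with $f_j(\boldsymbol{\theta})=\frac{J_n}{2}\|\mathbf{Z}^{(n)}(j,:)(\mathbf{A}^{(n)})^\top-\mathbf{X}_{(n)}^\top(j,:)\|_2^2$. Sampling probabilities for the rows of $\mathbf{Z}^{(n)}$, where $j$ corresponds to $(i_k)_{k\neq n}$: (i) leverage-based: $p_j=\prod_{k\ne n}\ell_{i_k}(\mathbf{A}^{(k)})/R$, where the leverage score is $\ell_i(\mathbf{A})=\|\mathbf{Q}(i,:)\|_2^2$ for any $\mathbf{Q}\in\mathbb{R}^{I_k\times R}$ whose columns form an orthonormal basis of the column space of $\mathbf{A}$ (so the $\mathbf{A}^{(k)}$, $k\ne n$, have full column rank); (ii) Euclidean-based: $p_j=\prod_{k\ne n}\|\mathbf{A}^{(k)}(i_k,:)\|_2^2/\|\mathbf{A}^{(k)}\|_F^2$ (so the $\mathbf{A}^{(k)}$, $k\neq n$, are nonzero). Process: $\boldsymbol{\theta}_{(0)}$ is given. At iteration $t$, a mode $\xi_{(t)}=n$ is drawn uniformly from $\{1,\dots,N\}$, independently of the past. Then, given the past and $n$, a batch $\zeta_{(t)}=(j_1,\dots,j_{|\mathcal{F}_n|})$ of fixed size $|\mathcal{F}_n|\ge1$ is drawn i.i.d. (with replacement) from $(p_j)_{j=1}^{J_n}$ computed at $\boldsymbol{\theta}_{(t)}$. The stochastic gradient is $$\mathbf{G}^{(n)}_{(t)}=\frac{1}{|\mathcal{F}_n|J_n}\sum_{s=1}^{|\mathcal{F}_n|}\frac1{p_{j_s}}\nabla_{\mathbf{A}^{(n)}}f_{j_s}(\boldsymbol{\theta}_{(t)}),$$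 and $\boldsymbol{\theta}_{(t+1)}$ is obtained by $\mathbf{A}^{(n)}_{(t+1)}=\mathbf{A}^{(n)}_{(t)}-\alpha_t\mathbf{G}^{(n)}_{(t)}$ with a deterministic step size $\alpha_t$, leaving the other factor matrices unchanged. $\mathbb{E}_{\zeta_{(t)}}[\cdot\mid\mathcal{B}_{(t)},\xi_{(t)}]$ denotes conditional expectation over $\zeta_{(t)}$. *)

(* Defs.v *)
From HB Require Import structures.
From mathcomp Require Import all_boot all_order all_algebra.
From mathcomp Require Import all_classical all_reals all_analysis.

Set Implicit Arguments.
Unset Strict Implicit.
Unset Printing Implicit Defensive.

Import Order.TTheory GRing.Theory Num.Theory.
Import numFieldNormedType.Exports.

Local Open Scope classical_set_scope.
Local Open Scope ring_scope.

Section Matrices.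
Context {R : realType}.

Definition frob m p (A : 'M[R]_(m, p)) : R :=
  Num.sqrt (\sum_i \sum_s A i s ^+ 2).

(* Gradient of a scalar function of a matrix: the matrix of its partial
   derivatives. *)
Definition mxgrad m p (g : 'M[R]_(m, p) -> R) (A : 'M[R]_(m, p)) :
    'M[R]_(m, p) :=
  \matrix_(i, s) 'D_(delta_mx i s) (g : 'M[R]_(m, p) -> R^o) A.

(* The columns of Q are an orthonormal basis of the column space of A; as Q has
   as many columns as A, such a Q exists exactly when A has full column rank. *)
Definition orthobasis m p (A Q : 'M[R]_(m, p)) : Prop :=
  Q^T *m Q = 1%:M /\ (Q^T :=: A^T)%MS.

(* Q is chosen arbitrarily among the orthonormal bases; leverageE below shows
   that the score does not depend on this choice. *)
Definition leverage m p (A : 'M[R]_(m, p)) (i : 'I_m) : R :=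
  frob (row i (xget 0 [set Q | orthobasis A Q])) ^+ 2.

Lemma frob_rowE m p (A : 'M[R]_(m, p)) i :
  frob (row i A) ^+ 2 = (A *m A^T) i i.
Proof.
rewrite /frob big_ord1 sqr_sqrtr; last by apply: sumr_ge0 => s _; exact: sqr_ge0.
by rewrite mxE; apply: eq_bigr => s _; rewrite !mxE expr2.
Qed.

Lemma leverageE m p (A Q : 'M[R]_(m, p)) (i : 'I_m) :
  orthobasis A Q -> leverage A i = frob (row i Q) ^+ 2.
Proof.
move=> hQ; rewrite /leverage; case: xgetP => [Q' _ /= hQ'|/(_ Q)]; last by case.
rewrite !frob_rowE; congr ((_ : 'M[R]_m) _ _).
case: hQ hQ' => QQ eQ [QQ' eQ'].
have /submxP[M eM] : (Q'^T <= Q^T)%MS by rewrite eQ eQ'.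
have {}eM : Q' = Q *m M^T by rewrite -[LHS]trmxK eM trmx_mul trmxK.
have MM : M *m M^T = 1%:M.
  by rewrite -QQ' eM trmx_mul trmxK mulmxA -(mulmxA M) QQ mulmx1.
by rewrite eM trmx_mul trmxK mulmxA -(mulmxA Q) (mulmx1C MM) mulmx1.
Qed.

Inductive scheme := LeverageBased | EuclideanBased.

Definition admissible (c : scheme) m p (A : 'M[R]_(m, p)) : Prop :=
  match c with
  | LeverageBased => \rank A = p
  | EuclideanBased => A != 0
  end.

Definition row_weight (c : scheme) m p (A : 'M[R]_(m, p)) (i : 'I_m) : R :=
  match c with
  | LeverageBased => leverage A i / p%:R
  | EuclideanBased => frob (row i A) ^+ 2 / frob A ^+ 2
  end.

End Matrices.

(* All modes, indices and columns are numbered from 0. *)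
Section CPDecomposition.
Context {R : realType} {N r : nat} {I : 'I_N -> nat}.

Definition multi_index := {dffun forall k : 'I_N, 'I_(I k)}.
Definition tensor := {ffun multi_index -> R}.
Definition params := forall k : 'I_N, 'M[R]_(I k, r).

Definition tnorm (T : tensor) : R := Num.sqrt (\sum_i T i ^+ 2).

Definition cp (theta : params) : tensor :=
  [ffun i : multi_index => \sum_(s < r) \prod_(k < N) theta k (i k) s].

Definition objective (X : tensor) (theta : params) : R :=
  2^-1 * tnorm (X - cp theta) ^+ 2.

Definition block_grad (n : 'I_N) (F : params -> R) (theta : params) :
    'M[R]_(I n, r) :=
  mxgrad (fun B => F (eqtype.dfwith theta B)) (theta n).

Definition ncols (n : 'I_N) : nat := (\prod_(m < N | m != n) I m)%N.

Definition stride (n : 'I_N) (k : nat) : nat :=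
  (\prod_(m < N | (m < k)%N && (m != n)) I m)%N.

Section Unfolding.
Hypothesis hI : forall k, (r < I k)%N.

(* The component i_k (k != n) of the multi-index encoded by the column number
   j = \sum_(k != n) i_k * stride n k; see digitK. *)
Definition digit (n : 'I_N) (j : 'I_(ncols n)) (k : 'I_N) : 'I_(I k) :=
  Ordinal (ltn_pmod (j %/ stride n k) (leq_ltn_trans (leq0n r) (hI k))).

Lemma digitK (n : 'I_N) (j : 'I_(ncols n)) :
  (\sum_(k < N | k != n) digit j k * stride n k)%N = j.
Proof.
pose S K := (\sum_(k < N | (k < K)%N && (k != n)) digit j k * stride n k)%N.
have -> : (\sum_(k < N | k != n) digit j k * stride n k)%N = S N.
  by apply: eq_bigl => k; rewrite ltn_ord.
have eN : stride n N = ncols n by apply: eq_bigl => k; rewrite ltn_ord.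
suff H (K : nat) : (K <= N)%N -> S K = (j %% stride n K)%N.
  by rewrite (H _ (leqnn N)) modn_small ?eN ?ltn_ord.
elim: K => [_|K IH ltKN].
  by rewrite /S /stride !big_pred0 // modn1.
have eS (k : 'I_N) : (k < K.+1)%N && (k != n) =
    ((k < K)%N && (k != n)) || ((k == Ordinal ltKN) && (k != n)).
  by rewrite -!val_eqE /= ltnS leq_eqVlt orbC andb_orl.
have [nK|nK] := eqVneq (Ordinal ltKN) n.
  have eS' (k : 'I_N) : (k < K.+1)%N && (k != n) = (k < K)%N && (k != n).
    by rewrite eS nK andbN orbF.
  by rewrite /S /stride !(eq_bigl _ _ eS') -/(S K) -/(stride n K) IH // ltnW.
rewrite /S (bigD1 (Ordinal ltKN)) /= ?ltnSn //.
rewrite (eq_bigl (fun k : 'I_N => (k < K)%N && (k != n))); last first.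
  move=> k; rewrite -!val_eqE /= ltnS [(k < K)%N]ltn_neqAle.
  by case: (k == K :> nat); rewrite ?andbF ?andbT.
rewrite -/(S K) IH; last exact: ltnW.
have -> : stride n K.+1 = (I (Ordinal ltKN) * stride n K)%N.
  rewrite /stride (bigD1 (Ordinal ltKN)) /= ?ltnSn //; congr (_ * _)%N.
  apply: eq_bigl => k; rewrite -!val_eqE /= ltnS [(k < K)%N]ltn_neqAle.
  by case: (k == K :> nat); rewrite ?andbF ?andbT.
set a := stride n K; set c := I _.
have c0 : (0 < c)%N by exact: leq_ltn_trans (hI _).
have a0 : (0 < a)%N by apply: prodn_gt0 => k; exact: leq_ltn_trans (hI _).
rewrite [X in (X %% (c * a))%N](divn_eq j a) {2}(divn_eq (j %/ a) c).
rewrite mulnDl -mulnA -addnA modnMDl [RHS]modn_small //.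
apply: leq_trans (_ : ((j %/ a) %% c).+1 * a <= _)%N.
  by rewrite mulSn addnC ltn_add2r ltn_mod.
by rewrite leq_mul2r ltn_mod c0 orbT.
Qed.

Definition unfold_index (n : 'I_N) (i : 'I_(I n)) (j : 'I_(ncols n)) :
    multi_index :=
  [ffun k => eqtype.dfwith (digit j) i k].

Definition unfolding (n : 'I_N) (X : tensor) : 'M[R]_(I n, ncols n) :=
  \matrix_(i, j) X (unfold_index i j).

Definition khatri_rao (n : 'I_N) (theta : params) : 'M[R]_(ncols n, r) :=
  \matrix_(j, s) \prod_(k < N | k != n) theta k (digit j k) s.

Definition objective_row (X : tensor) (n : 'I_N) (j : 'I_(ncols n))
    (theta : params) : R :=
  (ncols n)%:R / 2 *
  frob (row j (khatri_rao n theta) *m (theta n)^T - row j (unfolding n X)^T)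
    ^+ 2.

Definition row_prob (c : scheme) (theta : params) (n : 'I_N)
    (j : 'I_(ncols n)) : R :=
  \prod_(k < N | k != n) row_weight c (theta k) (digit j k).

Section Algorithm.
Variables (b : 'I_N -> nat) (c : scheme) (X : tensor).

Definition batch (n : 'I_N) := {ffun 'I_(b n) -> 'I_(ncols n)}.

(* The values of a pair (xi_(t), zeta_(t)): a mode and a batch for that mode. *)
Definition sample := {n : 'I_N & batch n}.

(* A term with row_prob = 0 carries a conventional inverse, but is drawn with
   probability 0. *)
Definition stoch_grad (theta : params) (n : 'I_N) (z : batch n) :
    'M[R]_(I n, r) :=
  ((b n)%:R * (ncols n)%:R)^-1 *:
  \sum_(s < b n) (row_prob c theta (z s))^-1 *:
    block_grad n (objective_row X (z s)) theta.

Definition step (theta : params) (a : R) (x : sample) : params :=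
  eqtype.dfwith theta (theta (tag x) - a *: stoch_grad theta (tagged x)).

Fixpoint iterate (theta0 : params) (alpha : nat -> R) (h : nat -> sample)
    (t : nat) : params :=
  if t is u.+1 then step (iterate theta0 alpha h u) (alpha u) (h u)
  else theta0.

Section Process.
Context {d : measure_display} {Omega : measurableType d}.
Variables (P : probability Omega R) (draw : nat -> Omega -> sample).

Definition mode (t : nat) (w : Omega) : 'I_N := tag (draw t w).

(* The sigma-algebra B_(t). *)
Definition past (t : nat) : set (set Omega) :=
  <<s [set E | exists u x, (u < t)%N /\ E = draw u @^-1` [set x] ] >>.

(* The sigma-algebra generated by B_(t) and xi_(t). *)
Definition past_mode (t : nat) : set (set Omega) :=
  <<s past t `|` [set E | exists n, E = mode t @^-1` [set n] ] >>.

Definition history (t : nat) (h : nat -> sample) : set Omega :=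
  [set w | forall u, (u < t)%N -> draw u w = h u].

(* The law of the draws. The row distribution at step t is only defined when
   the relevant factor matrices of the iterate are admissible, which is
   therefore required at every situation (past and mode) reached with positive
   probability. *)
Record sampling_process (theta0 : params) (alpha : nat -> R) : Prop := {
  draw_measurable : forall t x, measurable (draw t @^-1` [set x]);
  mode_uniform : forall t n E, past t E ->
    P (E `&` mode t @^-1` [set n]) = (P E * (N%:R^-1)%:E)%E;
  iterate_admissible : forall t h n,
    (0 < P (history t h `&` mode t @^-1` [set n]))%E ->
    forall k, k != n -> admissible c (iterate theta0 alpha h t k);
  batch_iid : forall t h n (z : batch n),
    (0 < P (history t h `&` mode t @^-1` [set n]))%E ->
    P (history t h `&` draw t @^-1` [set Tagged batch z]) =
    (P (history t h `&` mode t @^-1` [set n]) *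
     (\prod_(s < b n) row_prob c (iterate theta0 alpha h t) (z s))%:E)%E
}.

End Process.
End Algorithm.
End Unfolding.
End CPDecomposition.

Arguments multi_index {N} I.
Arguments tensor R {N} I.
Arguments params R {N} r I.
Arguments batch {N} I b n.
Arguments sample {N} I b.

(* Z is a version of the conditional expectation of Y given the
   sub-sigma-algebra F. *)
Definition is_cond_exp (R : realType) (d : measure_display)
    (Omega : measurableType d) (P : probability Omega R)
    (F : set (set Omega)) (Y Z : Omega -> R) : Prop :=
  [/\ P.-integrable setT (EFin \o Y),
      P.-integrable setT (EFin \o Z),
      (forall B : set R, measurable B -> F (Z @^-1` B)) &
      (forall E, F E ->
        (\int[P]_(w in E) (Z w)%:E = \int[P]_(w in E) (Y w)%:E)%E)].

(* Main.v *)
(* For a fixed iterate, f is the mean of the f_j, and the importance weight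
   1/p_j cancels the probability p_j of drawing j, so the stochastic gradient
   averages to the mean of the gradients of the f_j.  The cancellation fails
   only where p_j = 0, but then some A^(k), k != n, has a zero row i_k, hence
   Z^(n)(j,:) = 0 and f_j does not depend on A^(n).
   The draws up to time t take finitely many values, so B_(t) and xi_(t)
   generate the sigma-algebra of a finite partition; on each of its atoms of
   positive probability the iterate and the mode are fixed, which reduces the
   conditional expectation to the average above. *)
Require Import Defs.
From HB Require Import structures.
From mathcomp Require Import all_boot all_order all_algebra.
From mathcomp Require Import all_classical all_reals all_analysis.

Set Implicit Arguments.
Unset Strict Implicit.
Unset Printing Implicit Defensive.

Import Order.TTheory GRing.Theory Num.Theory.
Import numFieldNormedType.Exports.

Local Open Scope classical_set_scope.
Local Open Scope ring_scope.

(** * Sums of products over finite families *)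

(** The types [T i] vary with [i], so each sum is moved into the tagged union, where ordinary
    distributivity applies; the resulting families correspond bijectively to dependent functions. *)
Lemma bigA_distr_dffun (R : comPzSemiRingType) (I : finType) (T : I -> finType)
    (F : forall i, T i -> R) :
  \prod_(i : I) \sum_(x : T i) F i x =
  \sum_(f : {dffun forall i, T i}) \prod_(i : I) F i (f i).
Proof.
pose P i := [ffun x => F i x].
transitivity (\prod_i \sum_(x : T i) P i x).
  by apply: eq_bigr => i _; apply: eq_bigr => x _; rewrite ffunE.
under eq_bigr => i _ do rewrite (big_tag P).
rewrite (bigA_distr_big_dep _ (fun i j => untag 0 (P i) j)).
rewrite -big_fprod (reindex _ (onW_bij _ (@fprod_of_dffun_bij _ T))) /=.
by apply: eq_bigr => f _; apply: eq_bigr => i _; rewrite fprodE ffunE.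
Qed.

(** Marginalisation for independent draws: [G] is absorbed into the factor at [k0], the sum factors
    over the coordinates, and every other factor is 1. *)
Lemma sum_prod_marginal (R : comPzSemiRingType) (K J : finType) (p G : J -> R)
    (k0 : K) :
  \sum_j p j = 1 ->
  \sum_(z : {ffun K -> J}) G (z k0) * \prod_k p (z k) = \sum_j G j * p j.
Proof.
move=> p1; pose F k j := (if k == k0 then G j else 1) * p j.
transitivity (\sum_(z : {ffun K -> J}) \prod_k F k (z k)).
  apply: eq_bigr => z _; rewrite /F big_split /=; congr (_ * _).
  by rewrite -big_mkcond /= big_pred1_eq.
rewrite -bigA_distr_bigA (bigD1 k0) //= [X in _ * X]big1 ?mulr1; last first.
  move=> k /negPf nk; rewrite -p1; apply: eq_bigr => j _.
  by rewrite /F nk mul1r.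
by apply: eq_bigr => j _; rewrite /F eqxx.
Qed.

(** * Frobenius norms, orthonormal bases and row weights *)

Section Frobenius.
Context {R : realType}.

Lemma frob_sqr m p (A : 'M[R]_(m, p)) : frob A ^+ 2 = \sum_i \sum_j A i j ^+ 2.
Proof.
by rewrite sqr_sqrtr // !sumr_ge0 // => i _; rewrite sumr_ge0 // => j _;
  exact: sqr_ge0.
Qed.

Lemma frob_row_sqr m p (A : 'M[R]_(m, p)) i :
  frob (row i A) ^+ 2 = \sum_j A i j ^+ 2.
Proof. by rewrite frob_sqr big_ord1; apply: eq_bigr => j _; rewrite mxE. Qed.

Lemma frob_eq0 m p (A : 'M[R]_(m, p)) : (frob A == 0) = (A == 0).
Proof.
apply/idP/eqP => [|->]; last first.
  by rewrite -sqrf_eq0 frob_sqr big1 // => i _; rewrite big1 // => j _;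
    rewrite mxE expr0n.
rewrite -sqrf_eq0 frob_sqr psumr_eq0 => [/allP A0|i _]; last first.
  by apply: sumr_ge0 => j _; exact: sqr_ge0.
apply/matrixP => i j; rewrite mxE; have := A0 i (mem_index_enum _).
rewrite psumr_eq0 => [/allP /(_ j (mem_index_enum _))|? _]; last exact: sqr_ge0.
by rewrite sqrf_eq0 => /eqP.
Qed.

Lemma frob_sqrDZ p (u v : 'rV[R]_p) (h : R) :
  frob (u + h *: v) ^+ 2 =
  frob u ^+ 2 + h * (2 * \sum_k u 0 k * v 0 k) + h ^+ 2 * frob v ^+ 2.
Proof.
rewrite !frob_sqr !big_ord1 !mulr_sumr -!big_split /=.
apply: eq_bigr => k _; rewrite !mxE sqrrD exprMn; congr (_ + _ + _).
by rewrite mulrCA -mulr_natl mulrCA.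
Qed.

(* Gram-Schmidt. *)
Lemma orthonormal_rows m p (A : 'M[R]_(p, m)) :
  row_free A -> exists2 Q : 'M[R]_(p, m), Q *m Q^T = 1%:M & (Q :=: A)%MS.
Proof.
elim: p A => [|p IH]; first by move=> A _; exists A => //; apply/matrixP => -[].
rewrite -[p.+1]/(1 + p)%N => A fA; rewrite -[A]vsubmxK in fA *.
set u := usubmx _ in fA *; set B := dsubmx _ in fA *.
(* The first row accounts for at most one unit of the full rank [p.+1], which leaves rank [p] for
   [B]. *)
have fB : row_free B.
  rewrite -row_leq_rank; have := fA; rewrite -row_leq_rank.
  rewrite -addsmxE => /leq_trans /(_ (mxrank_adds_leqif _ _)).
  move=> /leq_trans /(_ (leq_add (rank_leq_row u) (leqnn _))).
  by rewrite leq_add2l.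
have [Q QQ eQ] := IH _ fB.
(* The component of [u] orthogonal to the rows of [Q]; it is nonzero because otherwise [u] would lie
   in the row space of [B]. *)
pose w := u - u *m Q^T *m Q.
have wQ : w *m Q^T = 0 by rewrite mulmxBl -!mulmxA QQ mulmx1 subrr.
have w0 : w != 0.
  apply/negP; rewrite subr_eq0 => /eqP uE.
  have uB : (u <= B)%MS by rewrite -eQ uE submxMl.
  move: fA; apply/negP; rewrite -row_leq_rank -addsmxE (addsmx_idPr uB) -ltnNge.
  exact: leq_ltn_trans (rank_leq_row _) _.
have c0 : frob w != 0 by rewrite frob_eq0.
have ww : w *m w^T = (frob w ^+ 2)%:M.
  rewrite [LHS]mx11_scalar; congr _%:M; rewrite frob_sqr big_ord1 mxE.
  by apply: eq_bigr => k _; rewrite [w^T _ _]mxE expr2.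
exists (col_mx ((frob w)^-1 *: w) Q).
  rewrite tr_col_mx mul_col_row QQ linearZ /= -!scalemxAl -!scalemxAr ww.
  rewrite wQ -[Q *m w^T]trmxK trmx_mul trmxK wQ trmx0 !scaler0.
  rewrite scalar_mx_block; congr block_mx.
  by rewrite scalerA scale_scalar_mx -invfM -expr2 mulVf // sqrf_eq0.
apply: (eqmx_trans (eqmx_sym (addsmxE _ _))).
apply: eqmx_trans (addsmxE u B).
apply: (eqmx_trans (adds_eqmx (eqmx_scale _ _) eQ)); first by rewrite invr_eq0.
apply/eqmxP/andP; split; rewrite addsmx_sub addsmxSr andbT.
  apply: addmx_sub; first exact: addsmxSl.
  by rewrite eqmx_opp (submx_trans (submxMl _ _)) // eQ addsmxSr.
have -> : u = w + u *m Q^T *m Q by rewrite subrK.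
apply: addmx_sub; first exact: addsmxSl.
by rewrite (submx_trans (submxMl _ _)) // eQ addsmxSr.
Qed.

(** Ensures that the choice made in [leverage] does not fall back on its default value 0. *)
Lemma orthobasis_exists m p (A : 'M[R]_(m, p)) :
  \rank A = p -> exists Q, orthobasis A Q.
Proof.
move=> rA; have [|Q QQ eQ] := @orthonormal_rows _ _ A^T.
  by rewrite /row_free mxrank_tr rA.
by exists Q^T; rewrite /orthobasis trmxK.
Qed.

(** Leverage scores are the diagonal entries of [Q *m Q^T], whose trace is that of [Q^T *m Q], the
    identity of size [p]. *)
Lemma sum_row_weight c m p (A : 'M[R]_(m, p)) :
  (0 < p)%N -> admissible c A -> \sum_i row_weight c A i = 1.
Proof.
move=> p0; case: c => /= [/orthobasis_exists[Q hQ]|A0]; rewrite -mulr_suml.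
  transitivity (\tr (Q *m Q^T) / p%:R).
    congr (_ / _); apply: eq_bigr => i _.
    by rewrite (leverageE _ hQ) frob_rowE.
  by rewrite mxtrace_mulC hQ.1 mxtrace1 divff // pnatr_eq0 -lt0n.
rewrite frob_sqr -(eq_bigr _ (fun i _ => frob_row_sqr A i)).
rewrite divff // (eq_bigr _ (fun i _ => frob_row_sqr A i)) -frob_sqr.
by rewrite sqrf_eq0 frob_eq0.
Qed.

(** In the leverage case [A] factors as [Q] times a matrix, so a zero row of [Q] forces a zero row
    of [A]. *)
Lemma row_weight_eq0 c m p (A : 'M[R]_(m, p)) i :
  (0 < p)%N -> admissible c A -> row_weight c A i = 0 -> row i A = 0.
Proof.
move=> p0; case: c => /= [/orthobasis_exists[Q hQ]|A0] /eqP.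
  rewrite mulf_eq0 invr_eq0 pnatr_eq0 [_ == 0%N]eqn0Ngt p0 orbF.
  rewrite (leverageE _ hQ) sqrf_eq0 frob_eq0 => /eqP Qi.
  have /submxP[M eM] : (A^T <= Q^T)%MS by rewrite hQ.2.
  by rewrite -[A]trmxK eM trmx_mul trmxK row_mul Qi mul0mx.
by rewrite mulf_eq0 invr_eq0 !sqrf_eq0 !frob_eq0 (negPf A0) orbF => /eqP.
Qed.

End Frobenius.

(** For nonzero [h] the difference quotient is exactly [b + h * c]. Squared norms of affine maps
    have this form. *)
Lemma is_derive_quadratic (R : realType) (V : normedModType R) (f : V -> R^o)
    (a v : V) (b c : R) :
  (forall h : R, f (h *: v + a) = f a + h * b + h ^+ 2 * c) ->
  is_derive a v f b.
Proof.
move=> fE.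
have cf : (fun h : R => h^-1 *: (f (h *: v + a) - f a)) @ 0^' --> b.
  apply: (@cvg_trans _ ((fun h : R => b + h * c) @ 0^')).
    apply: near_eq_cvg; near=> h.
    rewrite fE -[f a + _ + _]addrA [f a + _]addrC addrK expr2 -mulrA.
    have h0 : h != 0 by near: h; exact: nbhs_dnbhs_neq.
    by rewrite -mulrDr /GRing.scale /= mulKf.
  have -> : b = b + 0 * c by rewrite mul0r addr0.
  apply: cvgD; first by rewrite mul0r addr0; exact: cvg_cst.
  apply: cvgMl; exact: cvg_within.
split; first by apply/cvg_ex; exists b.
exact: cvg_lim cf.
Unshelve. all: by end_near. Qed.

(** * Unfolded objective and mean of the stochastic gradient at a fixed iterate *)

Section StochasticGradient.
Context {R : realType} {N r : nat} {I : 'I_N -> nat}.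
Hypothesis hr : (0 < r)%N.
Hypothesis hI : forall k, (r < I k)%N.

Lemma unfold_index_in n (i : 'I_(I n)) (j : 'I_(ncols n)) :
  unfold_index hI i j n = i.
Proof. by rewrite ffunE dfwith_in. Qed.

Lemma unfold_index_out n (i : 'I_(I n)) (j : 'I_(ncols n)) k :
  k != n -> unfold_index hI i j k = digit hI j k.
Proof. by move=> kn; rewrite ffunE dfwith_out // eq_sym. Qed.

(** Injectivity: the row is read off at mode [n], and [digitK] rebuilds the column from its digits.
    Equal cardinalities do the rest. *)
Lemma unfold_index_bij n :
  bijective (fun q : 'I_(I n) * 'I_(ncols n) => unfold_index hI q.1 q.2).
Proof.
apply: inj_card_bij => [[i j] [i' j'] /= e|].
  have ei : i = i' by rewrite -(unfold_index_in i j) e unfold_index_in.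
  congr pair => //; apply: val_inj; rewrite /= -(digitK hI j) -(digitK hI j').
  by apply: eq_bigr => k kn; rewrite -!(unfold_index_out i) // e ei.
rewrite card_dep_ffun foldrE big_image /= card_prod !card_ord (bigD1 n) //=.
by rewrite card_ord; under eq_bigr do rewrite card_ord.
Qed.

Lemma ncols_neq0 n : (ncols (I := I) n)%:R != 0 :> R.
Proof.
rewrite pnatr_eq0 -lt0n prodn_gt0 // => k; exact: leq_ltn_trans (hI k).
Qed.

(** The digits of [j] range independently over all modes other than [n], so [row_prob] is a product
    distribution. *)
Lemma sum_prod_digit n (F : forall k, 'I_(I k) -> R) :
  \sum_(j < ncols n) \prod_(k < N | k != n) F k (digit hI j k) =
  \prod_(k < N | k != n) \sum_(x < I k) F k x.
Proof.
have In0 : (I n)%:R != 0 :> R.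
  by rewrite pnatr_eq0 -lt0n (leq_ltn_trans _ (hI n)).
(* The constant weight 1 / I n in mode n turns the sum over j into a sum over
   all multi-indices without changing its value. *)
pose G k x := if k == n then (I n)%:R^-1 else F k x.
have GP (f : multi_index I) :
    \prod_(k < N) G k (f k) = (I n)%:R^-1 * \prod_(k < N | k != n) F k (f k).
  rewrite (bigD1 n) //= /G eqxx; congr (_ * _).
  by apply: eq_bigr => k /negPf ->.
transitivity (\prod_(k < N) \sum_(x < I k) G k x); last first.
  rewrite (bigD1 n) //= [X in X * _](_ : _ = 1) ?mul1r.
    by apply: eq_bigr => k /negPf kn; apply: eq_bigr => x _; rewrite /G kn.
  by rewrite /G eqxx sumr_const card_ord -[_^-1 *+ _]mulr_natl divff.
rewrite bigA_distr_dffun (reindex _ (onW_bij _ (unfold_index_bij n))) /=.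
rewrite -(pair_bigA _ (fun i j => \prod_k G k (unfold_index hI i j k))) /=.
rewrite exchange_big /=; apply: eq_bigr => j _.
transitivity (\sum_(i < I n) (I n)%:R^-1 *
    \prod_(k < N | k != n) F k (digit hI j k)).
  by rewrite sumr_const card_ord -mulrnAl -[_^-1 *+ _]mulr_natl divff // mul1r.
apply: eq_bigr => i _; rewrite GP; congr (_ * _).
by apply: eq_bigr => k kn; rewrite unfold_index_out.
Qed.

Lemma cp_unfold_index (theta : params R r I) n i (j : 'I_(ncols n)) :
  cp theta (unfold_index hI i j) =
  (row j (khatri_rao hI n theta) *m (theta n)^T) 0 i.
Proof.
rewrite ffunE mxE; apply: eq_bigr => s _; rewrite !mxE (bigD1 n) //=.
rewrite unfold_index_in mulrC; congr (_ * _).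
by apply: eq_bigr => k kn; rewrite unfold_index_out.
Qed.

Lemma tnorm_sqr (T : tensor R I) : tnorm T ^+ 2 = \sum_i T i ^+ 2.
Proof. by rewrite sqr_sqrtr // sumr_ge0 // => i _; exact: sqr_ge0. Qed.

Lemma objective_mean_rows (X : tensor R I) n (theta : params R r I) :
  objective X theta =
  (ncols (I := I) n)%:R^-1 * \sum_(j < ncols n) objective_row hI X j theta.
Proof.
rewrite /objective /objective_row tnorm_sqr -mulr_sumr mulrA mulrA.
rewrite mulVf ?ncols_neq0 // mul1r; congr (_ * _).
rewrite (reindex _ (onW_bij _ (unfold_index_bij n))) /=.
rewrite -(pair_bigA _ (fun i j => (X - cp theta) (unfold_index hI i j) ^+ 2)).
rewrite exchange_big /=; apply: eq_bigr => j _.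
rewrite frob_sqr big_ord1; apply: eq_bigr => i _.
(* The tensor residual is data minus model, the row residual model minus data. *)
rewrite -[LHS]sqrrN; congr (_ ^+ 2); rewrite [RHS]mxE -cp_unfold_index.
by rewrite ffunE [X in - (_ + X)]ffunE opprB; congr (_ + _); rewrite !mxE.
Qed.

(** The product skips mode [n]; hence each f_j is quadratic in the [n]-th factor. *)
Lemma khatri_rao_dfwith (theta : params R r I) n (B : 'M[R]_(I n, r)) :
  khatri_rao hI n (eqtype.dfwith theta B) = khatri_rao hI n theta.
Proof.
apply/matrixP => j s; rewrite !mxE; apply: eq_bigr => k kn.
by rewrite dfwith_out // eq_sym.
Qed.

(** Derivatives are limits, so exchanging them with the sum over [j] requires each summand to be
    derivable. *)
Lemma derivable_objective_row (X : tensor R I) (theta : params R r I) n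
    (j : 'I_(ncols n)) (A V : 'M[R]_(I n, r)) :
  derivable ((fun B => objective_row hI X j (eqtype.dfwith theta B)) :
    'M[R]_(I n, r) -> R^o) A V.
Proof.
pose Zj := row j (khatri_rao hI n theta).
pose u := Zj *m A^T - row j (unfolding hI n X)^T.
pose v := Zj *m V^T.
pose J := (ncols (I := I) n)%:R / 2 : R.
apply: (@ex_derive _ _ _ _ _ _ (J * (2 * \sum_k u 0 k * v 0 k))).
apply: (@is_derive_quadratic _ _ _ _ _ _ (J * frob v ^+ 2)) => h.
rewrite /objective_row !khatri_rao_dfwith !dfwith_in -/Zj -/J.
have -> : Zj *m (h *: V + A)^T - row j (unfolding hI n X)^T = u + h *: v.
  by rewrite linearD linearZ /= mulmxDr -scalemxAr -addrA addrC.
by rewrite frob_sqrDZ !mulrDr; congr (_ + _ + _); exact: mulrCA.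
Qed.

Lemma block_grad_objective (X : tensor R I) (theta : params R r I) n :
  block_grad n (objective X) theta = (ncols (I := I) n)%:R^-1 *:
    \sum_(j < ncols n) block_grad n (objective_row hI X j) theta.
Proof.
apply/matrixP => i s; rewrite mxE mxE summxE.
pose f (j : 'I_(ncols n)) : 'M[R]_(I n, r) -> R^o :=
  fun B => objective_row hI X j (eqtype.dfwith theta B).
have fE : (fun B : 'M[R]_(I n, r) => objective X (eqtype.dfwith theta B)) =
    (ncols (I := I) n)%:R^-1 \*: \sum_j f j.
  by apply/funext => B; rewrite (objective_mean_rows X n) /= fct_sumE.
rewrite (congr1 (fun F : _ -> R^o => 'D_(delta_mx i s) F (theta n)) fE).
have df j : derivable (f j) (theta n) (delta_mx i s).
  exact: derivable_objective_row.
rewrite deriveZ ?derive_sum //; last exact: derivable_sum.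
by congr (_ * _); apply: eq_bigr => j _; rewrite mxE.
Qed.

Lemma block_grad_objective_row0 (X : tensor R I) (theta : params R r I) n
    (j : 'I_(ncols n)) :
  row j (khatri_rao hI n theta) = 0 ->
  block_grad n (objective_row hI X j) theta = 0.
Proof.
move=> Z0; apply/matrixP => i s; rewrite !mxE.
pose k : R^o :=
  (ncols (I := I) n)%:R / 2 * frob (0 - row j (unfolding hI n X)^T) ^+ 2.
have fE : (fun B : 'M[R]_(I n, r) =>
    objective_row hI X j (eqtype.dfwith theta B)) = cst k.
  by apply/funext => B; rewrite /objective_row khatri_rao_dfwith Z0 mul0mx.
rewrite (congr1 (fun F : _ -> R^o => 'D_(delta_mx i s) F (theta n)) fE).
exact: derive_cst.
Qed.

Lemma sum_row_prob c (theta : params R r I) n :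
  (forall k, k != n -> admissible c (theta k)) ->
  \sum_(j < ncols n) row_prob hI c theta j = 1.
Proof.
move=> adm; rewrite (sum_prod_digit n (fun k => row_weight c (theta k))).
by apply: big1 => k kn; rewrite sum_row_weight //; exact: adm.
Qed.

Lemma row_prob_eq0 c (theta : params R r I) n (j : 'I_(ncols n)) :
  (forall k, k != n -> admissible c (theta k)) ->
  row_prob hI c theta j = 0 -> row j (khatri_rao hI n theta) = 0.
Proof.
move=> adm /eqP /prodf_eq0[k kn /eqP w0]; apply/matrixP => i s; rewrite !mxE.
apply/eqP/prodf_eq0; exists k => //; apply/eqP.
have /rowP/(_ s) := row_weight_eq0 hr (adm _ kn) w0.
by rewrite !mxE.
Qed.

(** By linearity each of the [b n] draws contributes the same marginal mean, and their number
    cancels the normalisation. *)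
Lemma expect_stoch_grad (b : 'I_N -> nat) c (X : tensor R I)
    (theta : params R r I) n i s :
  (0 < b n)%N -> (forall k, k != n -> admissible c (theta k)) ->
  \sum_(z : batch I b n)
    stoch_grad hI c X theta z i s * \prod_(q < b n) row_prob hI c theta (z q) =
  block_grad n (objective X) theta i s.
Proof.
move=> b0 adm; pose p (j : 'I_(ncols n)) := row_prob hI c theta j.
pose D (j : 'I_(ncols n)) := block_grad n (objective_row hI X j) theta i s.
have bnz : (b n)%:R != 0 :> R by rewrite pnatr_eq0 -lt0n.
transitivity (((b n)%:R * (ncols (I := I) n)%:R)^-1 *
    \sum_(q < b n) \sum_(z : batch I b n)
      (p (z q))^-1 * D (z q) * \prod_(q' < b n) p (z q')).
  rewrite exchange_big mulr_sumr /=; apply: eq_bigr => z _.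
  rewrite mxE summxE -mulrA; congr (_ * _); rewrite mulr_suml.
  by apply: eq_bigr => q _; rewrite mxE.
transitivity (((b n)%:R * (ncols (I := I) n)%:R)^-1 *
    \sum_(q < b n) \sum_(j < ncols n) D j).
  congr (_ * _); apply: eq_bigr => q _.
  rewrite (sum_prod_marginal (fun j => (p j)^-1 * D j)) ?sum_row_prob //.
  (* If [p j = 0] the weighted term is 0, and so is [D j], since row [j] of the Khatri-Rao matrix
     vanishes. *)
  apply: eq_bigr => j _; have [pj0|pj0] := eqVneq (p j) 0.
    rewrite pj0 mulr0 /D block_grad_objective_row0 ?mxE //.
    exact: row_prob_eq0 pj0.
  by rewrite mulrAC mulVf // mul1r.
rewrite sumr_const card_ord -[(\sum_j D j) *+ _]mulr_natl invfM mulrACA.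
by rewrite mulVf // mul1r block_grad_objective mxE summxE.
Qed.

End StochasticGradient.

(** * Conditional expectation for finitely valued variables *)

Section FiniteValued.
Context {R : realType} {d : measure_display} {Omega : measurableType d}.

(** Stated outside the fixed probability space so that it also applies to a generated
    sub-sigma-algebra. *)
Lemma measurable_preimage_fin (T : finType) (phi : Omega -> T) (S : set T) :
  (forall x, measurable (phi @^-1` [set x])) -> measurable (phi @^-1` S).
Proof.
move=> mphi; rewrite (_ : phi @^-1` S = \bigcup_(x in S) phi @^-1` [set x]).
  by apply: fin_bigcup_measurable => [|x _]; [exact: finite_finset|exact: mphi].
by apply/seteqP; split => [w Sw|w [x Sx /= ->]//]; exists (phi w).
Qed.

Variables (P : probability Omega R) (T : finType) (phi : Omega -> T).
Hypothesis mphi : forall x, measurable (phi @^-1` [set x]).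

Let finite_valuedE (g : T -> R) : EFin \o (g \o phi) =
  (fun w => \sum_(x : T) (g x)%:E * (\1_(phi @^-1` [set x]) w)%:E)%E.
Proof.
apply/funext => w; rewrite (bigD1 (phi w)) //= big1 ?adde0 => [|x xw].
  by rewrite indicE mem_set // mule1.
by rewrite indicE memNset ?mule0 // => /= e; rewrite e eqxx in xw.
Qed.

Let integrable_term (g : T -> R) x :
  P.-integrable setT (fun w => ((g x)%:E * (\1_(phi @^-1` [set x]) w)%:E)%E).
Proof. by apply: integrableZl => //; exact: integrable_indic. Qed.

Lemma integrable_finite_valued (g : T -> R) :
  P.-integrable setT (EFin \o (g \o phi)).
Proof.
by rewrite finite_valuedE; apply: integrable_sum => // x _;
  exact: integrable_term.
Qed.

Lemma integral_finite_valued (g : T -> R) (E : set Omega) : measurable E ->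
  (\int[P]_(w in E) (g (phi w))%:E =
   \sum_(x : T) (g x)%:E * P (E `&` phi @^-1` [set x]))%E.
Proof.
move=> mE; have -> : (fun w => (g (phi w))%:E) = EFin \o (g \o phi) by [].
have iE f : P.-integrable setT f -> P.-integrable E f.
  exact: (integrableS measurableT mE (@subsetT _ _)).
rewrite finite_valuedE integral_sum // => [|x]; last first.
  exact/iE/integrable_term.
apply: eq_bigr => x _; rewrite integralZl //; last exact/iE/integrable_indic.
by rewrite integral_indic // setIC.
Qed.

(** The events of [F] are unions of atoms, the fibres of [pi \o phi], so it suffices to compare
    integrals on each atom, where [k] is constant. *)
Lemma is_cond_exp_finite_valued (U : finType) (pi : T -> U)
    (F : set (set Omega)) (g : T -> R) (k : U -> R) :
  (forall E, F E <-> exists S, E = (pi \o phi) @^-1` S) ->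
  (forall u, (\sum_(x | pi x == u) (g x)%:E * P (phi @^-1` [set x]) =
              (k u)%:E * P ((pi \o phi) @^-1` [set u]))%E) ->
  is_cond_exp P F (g \o phi) (k \o (pi \o phi)).
Proof.
move=> FE gk; split.
- exact: integrable_finite_valued.
- exact: (integrable_finite_valued (k \o pi)).
- by move=> B _; apply/FE; exists (k @^-1` B).
move=> _ /FE[S ->]; have mS : measurable ((pi \o phi) @^-1` S).
  exact: (measurable_preimage_fin (pi @^-1` S) mphi).
rewrite (integral_finite_valued (k \o pi)) // (integral_finite_valued g) //.
(* Values of [phi] are grouped by atom; an atom lies inside the event or is disjoint from it. *)
rewrite (partition_big pi predT) // [RHS](partition_big pi predT) //=.
apply: eq_bigr => u _; have [Su|Su] := pselect (S u); last first.
  rewrite !big1 // => x /eqP xu;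
    rewrite (_ : _ `&` _ = set0) ?measure0 ?mule0 //;
    by apply/seteqP; split => // w [] /= Sw wx; apply: Su; rewrite -xu -wx.
have SI x : pi x == u -> (pi \o phi) @^-1` S `&` phi @^-1` [set x] =
    phi @^-1` [set x].
  by move=> /eqP xu; apply/setIidr => w /= ->; rewrite xu.
transitivity (\sum_(x | pi x == u) (k u)%:E * P (phi @^-1` [set x]))%E.
  by apply: eq_bigr => x xu; rewrite SI // (eqP xu).
transitivity (\sum_(x | pi x == u) (g x)%:E * P (phi @^-1` [set x]))%E;
  last by apply: eq_bigr => x xu; rewrite SI.
rewrite gk.
have mu : measurable ((pi \o phi) @^-1` [set u]).
  exact: (measurable_preimage_fin (pi @^-1` [set u]) mphi).
(* Integrating a constant over the atom splits its probability among the fibres of [phi]. *)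
have := integral_finite_valued (cst (k u)) mu.
rewrite (integral_cst P mu (k u)%:E) => ->.
rewrite [RHS](bigID (fun x => pi x == u)) /= [X in (_ + X)%E]big1 ?adde0.
  apply: eq_bigr => x /eqP xu; congr (_ * P _)%E; apply/esym/setIidr => w /= ->.
  by rewrite xu.
move=> x /eqP xu; rewrite (_ : _ `&` _ = set0) ?measure0 ?mule0 //.
by apply/seteqP; split => // w [] /= wu wx; apply: xu; rewrite -wx.
Qed.

End FiniteValued.

(** * The finite partition generated by the past draws and the mode *)

Section Process.
Context {R : realType} {N r : nat} {I : 'I_N -> nat} {b : 'I_N -> nat}.

Lemma eq_iterate (hI : forall k, (r < I k)%N) c (X : tensor R I)
    (theta0 : params R r I) (alpha : nat -> R) (h h' : nat -> sample I b) t :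
  (forall u, (u < t)%N -> h u = h' u) ->
  iterate hI c X theta0 alpha h t = iterate hI c X theta0 alpha h' t.
Proof.
elim: t => //= t IH hh'; rewrite IH ?hh' // => u ut.
by apply: hh'; exact: ltnW.
Qed.

Context {d : measure_display} {Omega : measurableType d}.
Variable draw : nat -> Omega -> sample I b.

(** A finite function, so that the past takes values in a finite type. *)
Definition past_draws t (w : Omega) : {ffun 'I_t -> sample I b} :=
  [ffun u : 'I_t => draw u w].

(* iterate takes infinite histories; the values from time t on are
   irrelevant. *)
Definition extend t (f : {ffun 'I_t -> sample I b}) (x : sample I b) (u : nat) :
    sample I b :=
  if insub u is Some v then f v else x.

Lemma extendE t (f : {ffun 'I_t -> sample I b}) x (u : 'I_t) :
  extend f x u = f u.
Proof. by rewrite /extend valK. Qed.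

Lemma extend_past_draws t w x u :
  (u < t)%N -> extend (past_draws t w) x u = draw u w.
Proof.
by move=> ut; rewrite -[u]/(nat_of_ord (Ordinal ut)) extendE ffunE.
Qed.

Lemma past_draws_fiber t (f : {ffun 'I_t -> sample I b}) :
  past_draws t @^-1` [set f] =
  \bigcap_(u in [set: 'I_t]) draw u @^-1` [set f u].
Proof.
apply/seteqP; split => [w <- u _|w hw]; first by rewrite /= ffunE.
by apply/ffunP => u; rewrite ffunE; exact: hw.
Qed.

Lemma history_extend t (f : {ffun 'I_t -> sample I b}) x :
  history draw t (extend f x) = past_draws t @^-1` [set f].
Proof.
apply/seteqP; split => [w hw|w /= <- u ut]; last by rewrite extend_past_draws.
by apply/ffunP => u; rewrite ffunE hw // extendE.
Qed.

(** Preimages of arbitrary sets form a sigma-algebra containing the generators; conversely each is a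
    finite union of fibres, themselves finite intersections of generators. *)
Lemma past_modeP t (E : set Omega) : past_mode draw t E <->
  exists S, E = (fun w => (past_draws t w, mode draw t w)) @^-1` S.
Proof.
set psi := (X in _ <-> exists S, E = X @^-1` S); split.
  suff sub : past_mode draw t `<=` preimage_set_system setT psi setT.
    by move=> /sub[S _ <-]; exists S; rewrite setTI.
  have sig : sigma_algebra setT (preimage_set_system setT psi setT).
    by apply: sigma_algebra_preimage; split.
  apply: smallest_sub => // A [|[n ->]].
    move: A; apply: smallest_sub => // A [u [x [ut ->]]].
    exists [set q : {ffun 'I_t -> sample I b} * 'I_N | q.1 (Ordinal ut) = x];
      first by [].
    by rewrite setTI; apply/seteqP; split => w /=; rewrite ffunE.
  by exists [set q | q.2 = n]; rewrite // setTI.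
pose G := past draw t `|` [set E | exists n, E = mode draw t @^-1` [set n]].
move=> [S ->].
rewrite -[past_mode draw t]/(@measurable _ (g_sigma_algebraType G)).
apply: (@measurable_preimage_fin _ (g_sigma_algebraType G)) => -[f n].
rewrite (_ : _ @^-1` _ =
    past_draws t @^-1` [set f] `&` mode draw t @^-1` [set n]); last first.
  by apply/seteqP; split => [w [<- <-]|w [/= <- <-]].
apply: measurableI.
  rewrite past_draws_fiber.
  apply: fin_bigcap_measurable => [|u _]; first exact: finite_finset.
  by apply: sub_sigma_algebra; left; apply: sub_sigma_algebra; exists u, (f u).
by apply: sub_sigma_algebra; right; exists n.
Qed.

End Process.

(* G^(xi_(t)) is a matrix whose number of rows depends on the random mode: its
   entries are addressed by a choice i of one row index for every mode, and a
   column index s. *)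
Theorem theorem5 (R : realType) (N r : nat) (I : 'I_N -> nat)
    (hr : (0 < r)%N) (hI : forall k, (r < I k)%N)
    (X : tensor R I) (c : scheme)
    (b : 'I_N -> nat) (hb : forall n, (0 < b n)%N)
    (theta0 : params R r I) (alpha : nat -> R)
    (d : measure_display) (Omega : measurableType d)
    (P : probability Omega R) (draw : nat -> Omega -> sample I b)
    (hdraw : sampling_process hI c X P draw theta0 alpha)
    (t : nat) (i : forall n : 'I_N, 'I_(I n)) (s : 'I_r) :
  let theta (w : Omega) : params R r I :=
    iterate hI c X theta0 alpha (fun u => draw u w) t in
  is_cond_exp P (past_mode draw t)
    (fun w => stoch_grad hI c X (theta w) (tagged (draw t w))
                (i (mode draw t w)) s)
    (fun w => block_grad (mode draw t w) (objective X) (theta w)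
                (i (mode draw t w)) s).
Proof.
(* An arbitrary filler for [extend], supplied by a draw at the base point of [Omega]. *)
pose x0 : sample I b := draw 0%N point.
pose past_theta (f : {ffun 'I_t -> sample I b}) :=
  iterate hI c X theta0 alpha (extend f x0) t.
(* [phi] records the past and the current draw; [pi] forgets the batch and keeps the mode. *)
pose phi w := (past_draws draw t w, draw t w).
pose pi (x : {ffun 'I_t -> sample I b} * sample I b) := (x.1, tag x.2).
pose g (x : {ffun 'I_t -> sample I b} * sample I b) :=
  stoch_grad hI c X (past_theta x.1) (tagged x.2) (i (tag x.2)) s.
pose k (u : {ffun 'I_t -> sample I b} * 'I_N) :=
  block_grad u.2 (objective X) (past_theta u.1) (i u.2) s.
move=> theta.
have thetaE w : theta w = past_theta (past_draws draw t w).
  by apply: eq_iterate => u ut; rewrite extend_past_draws.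
rewrite (_ : (fun w => stoch_grad _ _ _ _ _ _ _) = g \o phi); last first.
  by apply/funext => w; rewrite /g /= -thetaE.
rewrite (_ : (fun w => block_grad _ _ _ _ _) = k \o (pi \o phi)); last first.
  by apply/funext => w; rewrite /k /= -thetaE.
have mphi x : measurable (phi @^-1` [set x]).
  case: x => f y; rewrite (_ : _ @^-1` _ =
      past_draws draw t @^-1` [set f] `&` draw t @^-1` [set y]); last first.
    by apply/seteqP; split => [w [<- <-]|w [/= <- <-]].
  apply: measurableI; last exact: draw_measurable hdraw _ _.
  rewrite past_draws_fiber.
  apply: fin_bigcap_measurable => [|u _]; first exact: finite_finset.
  exact: draw_measurable hdraw _ _.
apply: is_cond_exp_finite_valued => // [E|[f n]]; first exact: past_modeP.
have atomE : (pi \o phi) @^-1` [set (f, n)] =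
    history draw t (extend f x0) `&` mode draw t @^-1` [set n].
  rewrite history_extend; apply/seteqP.
  by split => [w [<- <-]|w [/= <- <-]].
have matom : measurable ((pi \o phi) @^-1` [set (f, n)]).
  exact: (measurable_preimage_fin (pi @^-1` [set (f, n)]) mphi).
have sumE (F : {ffun 'I_t -> sample I b} * sample I b -> \bar R) :
    (\sum_(x | pi x == (f, n)) F x =
     \sum_(z : batch I b n) F (f, Tagged _ z))%E.
  transitivity
    (\sum_(f' | f' == f) \sum_(y : sample I b | tag y == n) F (f', y))%E.
    by rewrite pair_big; apply: eq_big => -[].
  rewrite big_pred1_eq.
  transitivity (\sum_(m | m == n) \sum_(z : batch I b m) F (f, Tagged _ z))%E.
    by rewrite sig_big_dep; apply: eq_big => -[m z] //=; rewrite andbT.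
  by rewrite big_pred1_eq.
(* On a null atom no batch law is prescribed, but all fibres of [phi] inside it are null too. *)
rewrite sumE; have [P0|Ppos] := eqVneq (P ((pi \o phi) @^-1` [set (f, n)])) 0%E.
  rewrite P0 mule0 big1 // => z _; rewrite (_ : P _ = 0%E) ?mule0 //.
  by apply: subset_measure0 P0 => // w /= ->.
have {}Ppos :
    (0 < P (history draw t (extend f x0) `&` mode draw t @^-1` [set n]))%E.
  by rewrite -atomE lt0e Ppos measure_ge0.
have adm := iterate_admissible hdraw Ppos.
rewrite /k /= -(expect_stoch_grad hr hI X (i n) s (hb n) adm).
rewrite -[P _]fineK ?fin_num_measure // -EFinM mulr_suml -sumEFin.
apply: eq_bigr => z _; rewrite EFinM fineK ?fin_num_measure //.
rewrite (_ : phi @^-1` _ =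
    history draw t (extend f x0) `&` draw t @^-1` [set Tagged _ z]).
  (* The fibre probability is that of the atom times the product law averaged in
     [expect_stoch_grad]. *)
  rewrite (batch_iid hdraw z Ppos) -atomE muleCA -EFinM.
  exact: muleC.
rewrite history_extend; apply/seteqP.
by split => [w [<- <-]|w [/= <- <-]].
Qed.
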